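(* For every $k\ge 1$, a matching of size $k$ has degree exactly $1$ in $\mathbf{DCM}_k$ if and only if it is an L-matching.
   Context: Let $k\ge 1$ and let $X_{2k}=\{P_1,\dots,P_{2k}\}$ be $2k$ points in convex position in the plane, labeled in clockwise cyclic order; indices are taken modulo $2k$. A matching of $X_{2k}$ means a set of $k$ pairwise non-crossing straight segments (edges) with endpoints in $X_{2k}$ covering every point exactly once; its size is $k$. Two matchings $M,M'$ of $X_{2k}$ are disjoint compatible if they have no common edge and no edge of $M$ crosses an edge of $M'$. $\mathbf{DCM}_k$ is the graph whose vertices are the matchings of $X_{2k}$, two being adjacent iff they are disjoint compatible. The rings of $X_{2k}$ ($k\ge 2$) are the two matchings consisting only of edges between consecutive points: $\{P_1P_2,P_3P_4,\dots,P_{2k-1}P_{2k}\}$ and $\{P_2P_3,P_4P_5,\dots,P_{2k}P_1\}$. A block of a matching $M$ is a pair of edges $\{P_iP_{i+3},P_{i+1}P_{i+2}\}\subseteq M$. If $K$ is a block of a matching $N$ of size $k+2$, then $N-K$ denotes the set $N\setminus K$, regarded as a matching of the remaining $2k$ points (which are in convex position) with their inherited cyclic order, i.e. as a matching of size $k$ defined up to cyclic relabeling. L-matchings are defined recursively: a matching of size $2$ or $3$ is an L-matching iff it is a ring; no matching of size $1$ is an L-matching; for $k\ge 4$, a matching $N$ of size $k$ is an L-matching iff it has a block $K$ such that $N-K$ is an L-matching. *)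

(* Defs.v *)
From HB Require Import structures.
From mathcomp Require Import all_boot.
Set Implicit Arguments. Unset Strict Implicit. Unset Printing Implicit Defensive.

(* Convention: the 2k points P_1..P_2k in convex position, clockwise, are
   labelled by 'I_n (n = 2k), with label j standing for P_(j+1). Cyclic
   successor is ordS. An edge (segment) is a 2-element subset of 'I_n. *)

Definition addo n (i : 'I_n) (j : nat) : 'I_n := iter j (@ordS n) i.

(* Two chords of points in convex position cross iff their endpoints
   interleave strictly in the cyclic order (checked in both orders). *)
Definition cross1 n (e f : {set 'I_n}) : bool :=
  [exists a : 'I_n, exists b : 'I_n, exists c : 'I_n, exists d : 'I_n,
     [&& e == [set a; b], f == [set c; d], (a < c)%N, (c < b)%N & (b < d)%N]].
Definition cross n (e f : {set 'I_n}) : bool := cross1 e f || cross1 f e.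

Definition is_matching n (M : {set {set 'I_n}}) : bool :=
  [&& [forall e in M, #|e| == 2],
      [forall x : 'I_n, #|[set e in M | x \in e]| == 1] &
      [forall e in M, forall f in M, ~~ cross e f]].

Definition dcompat n (M M' : {set {set 'I_n}}) : bool :=
  (M :&: M' == set0) && [forall e in M, forall f in M', ~~ cross e f].

Definition dcm_degree n (M : {set {set 'I_n}}) : nat :=
  #|[set M' : {set {set 'I_n}} | is_matching M' && dcompat M M']|.

Definition ringA n : {set {set 'I_n}} :=
  [set [set i; ordS i] | i : 'I_n & ~~ odd i].
Definition ringB n : {set {set 'I_n}} :=
  [set [set i; ordS i] | i : 'I_n & odd i].
Definition is_ring n (M : {set {set 'I_n}}) : bool :=
  (M == ringA n) || (M == ringB n).

Definition blockK n (i : 'I_n) : {set {set 'I_n}} :=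
  [set [set i; addo i 3]; [set addo i 1; addo i 2]].
Definition is_block n (N : {set {set 'I_n}}) (i : 'I_n) : bool :=
  blockK i \subset N.

(* Relabelling of the remaining points after deleting i, i+1, i+2, i+3:
   point p gets label (p - (i+4)) mod n, so the remaining points get labels
   0 .. n-5 in their inherited cyclic order (a cyclic relabelling). *)
Definition relab n (i : 'I_n) (p : 'I_n) : nat :=
  ((p : nat) + n - (((i : nat) + 4) %% n)) %% n.

Definition remove_block n (N : {set {set 'I_n}}) (i : 'I_n)
  : {set {set 'I_(n - 4)}} :=
  [set [set x : 'I_(n - 4) | [exists p : 'I_n, (p \in f) && (relab i p == (x : nat))]]
     | f : {set 'I_n} in N :\: blockK i].

Inductive Lmatching : forall n : nat, {set {set 'I_n}} -> Prop :=
| L_ring2 : forall M : {set {set 'I_4}}, is_matching M -> is_ring M -> Lmatching M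
| L_ring3 : forall M : {set {set 'I_6}}, is_matching M -> is_ring M -> Lmatching M
| L_step : forall n (N : {set {set 'I_n}}) (i : 'I_n),
    (8 <= n)%N -> is_matching N -> is_block N i ->
    Lmatching (remove_block N i) -> Lmatching N.

(* Main.v *)
Require Import Defs.
From HB Require Import structures.
From mathcomp Require Import all_boot.
From mathcomp Require Import zify_ssreflect.
Set Implicit Arguments. Unset Strict Implicit. Unset Printing Implicit Defensive.

(** A matching is encoded as a noncrossing fixed-point-free involution of [0, n);
the degree is 1 iff exactly one such involution solves the compatibility
constraints.

If a matching has a block, every compatible matching must join the block's four
points as {i, i+1}, {i+2, i+3}, so removing the block preserves the number of
solutions.  If a matching has no block, induction over its nested intervals shows
that every nonempty closed interval has a solution up to one visible chord {c, d}
that may be shared with the matching, and that every closed interval with more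
than two points has a genuine solution: an interval spanned by one chord swaps the
two kinds of solution of its interior, and for two adjacent intervals the two
visible chords are rewired into each other.  A blockless matching with n >= 8 splits,
after rotation, into two closed intervals with at least four points each; gluing
genuine solutions, or rewiring visible chords, gives two different solutions.  The
cases n <= 6 are settled directly. *)

(** * Solutions on closed intervals *)

Ltac split_ifs := repeat match goal with
  |- context [if ?c then _ else _] =>
    lazymatch c with
    | context [if _ then _ else _] => fail
    | _ => let E := fresh in case E: c => /=
    end
  end.

(** If two chords cross, exactly one end of the chord of [g] lies strictly inside the chord of [f];
    taking that end as [y] detects every crossing. The weak bounds allow common endpoints, hence
    common chords. *)
Definition noncrossing a b (f g : nat -> nat) : Prop :=
  forall x y, a <= x < b -> a <= y < b -> x < y -> y < f x -> x <= g y <= f x.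

Definition pairing a b (f : nat -> nat) : Prop :=
  forall x, a <= x < b -> a <= f x < b /\ f (f x) = x /\ f x <> x.

Definition matches a b (f : nat -> nat) : Prop :=
  pairing a b f /\ noncrossing a b f f.

Definition solves a b (f g : nat -> nat) : Prop :=
  [/\ matches a b g, noncrossing a b f g & forall x, a <= x < b -> g x <> f x].

(* Almost a solution: the chord {c, d} of [g] may belong to [f], but no chord of [f]
   or [g] separates it from the outside of [a, b), so it can be rewired later. *)
Definition presolves a b (f g : nat -> nat) c d : Prop :=
  [/\ matches a b g, noncrossing a b f g, a <= c /\ c < d /\ d < b /\ g c = d,
      forall x, a <= x < b -> x <> c -> x <> d -> g x <> f x &
      forall x, a <= x < b -> (x < c -> f x < c /\ g x < c) /\
                              (d < x -> d < f x /\ d < g x)].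

(** Blocks wrapping around the ends are ignored, so the property passes to subintervals; [no_block]
    below is the cyclic version. *)
Definition blockless a b (f : nat -> nat) : Prop :=
  forall x, a <= x -> x + 3 < b -> f x = x + 3 -> f (x + 1) <> x + 2.

Lemma matches_sub a b c d f : a <= c -> d <= b ->
  (forall x, c <= x < d -> c <= f x < d) -> matches a b f -> matches c d f.
Proof.
move=> ac db cl [pf nf]; split=> [x xcd|x y xcd ycd]; last by apply: nf; lia.
by have := pf x; have := cl x xcd; lia.
Qed.

(** A point inside the chord at [x] with its partner outside would give a crossing, so [f] preserves
    the interior. *)
Lemma matches_inside a b f x : matches a b f -> a <= x < b -> x < f x ->
  matches x.+1 (f x) f.
Proof.
move=> mf xab xfx; have [pf nf] := mf; have [fxab [fxK _]] := pf x xab.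
apply: matches_sub (mf) => [||y yx]; [by lia|by lia|].
have := nf x y; have := pf y.
case: (f y =P x) => [E|]; first by rewrite E; clear -yx xab fxab; lia.
case: (f y =P f x) => [E|]; first by rewrite E fxK; clear -yx xab fxab; lia.
by clear -yx xab fxab; lia.
Qed.

Lemma matches_after a b f : a < b -> matches a b f -> matches (f a).+1 b f.
Proof.
move=> ab mf; have [pf nf] := mf.
have [fa1 [faK fa3]] := pf a ltac:(lia).
apply: matches_sub (mf) => [||x xab]; [by lia|by []|].
have [fx1 [fxK _]] := pf x ltac:(lia).
have := nf a (f x); rewrite fxK.
case: (f x =P a) => [E|]; first by move: fxK; rewrite E; clear -xab; lia.
case: (f x =P f a) => [E|]; first by move: fxK; rewrite E faK; clear -xab fa1; lia.
by clear -ab fa1 fx1 xab fa3; lia.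
Qed.

Lemma matches_even a b f : matches a b f -> ~~ odd (b - a).
Proof.
have [n] := ubnP (b - a).
elim: n a b => // n IH a b ban mf.
have [ba|ab] : b <= a \/ a < b by lia.
  by have -> : b - a = 0 by lia.
have [pf _] := mf; have fa := pf a ltac:(lia).
have m1 := @matches_inside a b f a mf ltac:(lia) ltac:(lia).
have := IH a.+1 (f a) ltac:(lia) m1; have := IH (f a).+1 b ltac:(lia) (matches_after ab mf).
by clear -ab fa; lia.
Qed.

(** The points strictly under a chord are matched among themselves, so their number is even and the
    ends of the chord have opposite parity. *)
Lemma matches_odd a b f x : matches a b f -> a <= x < b -> odd (f x) = ~~ odd x.
Proof.
move=> mf xab; have [pf _] := mf; have [fx [fxK fxx]] := pf x xab.
have [lt|lt] : x < f x \/ f x < x by clear -fxx; lia.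
  by have := matches_even (matches_inside mf xab lt); clear -lt; lia.
have := @matches_inside a b f (f x) mf fx; rewrite fxK => /(_ lt)/matches_even.
by clear -lt; lia.
Qed.

Lemma presolves_visible a b f g c d x : pairing a b f -> presolves a b f g c d ->
  a <= x < b -> x <> c -> x <> d ->
  a <= g x < b /\ g (g x) = x /\ g x <> x /\ g x <> c /\ g x <> d /\
  ((x < c /\ g x < c) \/ (c < x < d /\ c < g x < d) \/ (d < x /\ d < g x)) /\
  g x <> f x.
Proof.
move=> pf [[pg ng] nfg [ac [cd [db gc]]] df vis] xab xc xd.
have [g1 [g2 g3]] := pg x xab.
have gd : g d = c by have := pg c; rewrite gc; lia.
have gxc : g x <> c by move=> E; move: g2; rewrite E; lia.
have gxd : g x <> d by move=> E; move: g2; rewrite E; lia.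
have := vis x xab; have := vis (g x) g1; have := df x xab xc xd.
by rewrite g2; lia.
Qed.

(** Visibility closes both outer regions under [f], and since [f] is an involution the middle one is
    closed too. Unlike for [g], the middle region includes [c] and [d]: [f] may join them to each
    other or to points between them. *)
Lemma presolves_stable a b f g c d x : pairing a b f -> presolves a b f g c d ->
  a <= x < b -> a <= f x < b /\
  ((x < c /\ f x < c) \/ (c <= x <= d /\ c <= f x <= d) \/ (d < x /\ d < f x)).
Proof.
move=> pf [_ _ [ac [cd [db _]]] _ vis] xab.
have [fxab [fxK _]] := pf x xab.
have := vis x xab; have := vis (f x) fxab; rewrite fxK.
clear -fxab xab cd; lia.
Qed.

(** The chords [{c1, d1}] and [{c2, d2}] become [{c1, d2}] and [{d1, c2}]. Both new chords join the
    two sides of [m], which no chord of [f] does, so the result is a genuine solution; the outer one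
    is visible again, so it is also a presolution. *)
Lemma presolves_cat a m b f g1 c1 d1 g2 c2 d2 :
  pairing a m f -> pairing m b f ->
  presolves a m f g1 c1 d1 -> presolves m b f g2 c2 d2 ->
  exists g, [/\ presolves a b f g c1 d2, g d1 = c2 & solves a b f g].
Proof.
move=> pf1 pf2 s1 s2.
have V1 x := @presolves_visible _ _ _ _ _ _ x pf1 s1.
have V2 x := @presolves_visible _ _ _ _ _ _ x pf2 s2.
have F1 x := @presolves_stable _ _ _ _ _ _ x pf1 s1.
have F2 x := @presolves_stable _ _ _ _ _ _ x pf2 s2.
case: s1 => [[pg1 ng1] nfg1 [ac1 [cd1 [db1 gc1]]] df1 vis1].
case: s2 => [[pg2 ng2] nfg2 [ac2 [cd2 [db2 gc2]]] df2 vis2].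
pose g (x : nat) : nat := if x == c1 then d2 else if x == d2 then c1 else
  if x == d1 then c2 else if x == c2 then d1 else
  if x < m then g1 x else g2 x.
have g1E x : x < m -> x <> c1 -> x <> d1 -> g x = g1 x.
  by rewrite /g => *; split_ifs; lia.
have g2E x : m <= x -> x <> c2 -> x <> d2 -> g x = g2 x.
  by rewrite /g => *; split_ifs; lia.
have [gc1' gd2 gd1 gc2'] : [/\ g c1 = d2, g d2 = c1, g d1 = c2 & g c2 = d1].
  by rewrite /g !eqxx; split=> //; split_ifs; lia.
clearbody g.
(* Every point is an end of a new chord, or keeps its old chord, which stays within one of the three
   regions cut out by [c1, d1] or by [c2, d2]. With this classification each remaining goal is
   linear arithmetic. *)
have gP x : a <= x < b ->
    ((x = c1 /\ g x = d2 \/ x = d2 /\ g x = c1) \/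
     (x = d1 /\ g x = c2 \/ x = c2 /\ g x = d1)) \/
    ((a <= x < m /\ a <= g1 x < m /\ g x = g1 x /\ g (g1 x) = x /\ g1 x <> x /\
     g1 x <> f x /\
     ((x < c1 /\ g1 x < c1) \/ (c1 < x < d1 /\ c1 < g1 x < d1) \/
      (d1 < x /\ d1 < g1 x))) \/
    (m <= x < b /\ m <= g2 x < b /\ g x = g2 x /\ g (g2 x) = x /\ g2 x <> x /\
     g2 x <> f x /\
     ((x < c2 /\ g2 x < c2) \/ (c2 < x < d2 /\ c2 < g2 x < d2) \/
      (d2 < x /\ d2 < g2 x)))).
  move=> xab.
  case: (x =P c1) => [->|xc1]; first by tauto.
  case: (x =P d2) => [->|xd2]; first by tauto.
  case: (x =P d1) => [->|xd1]; first by tauto.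
  case: (x =P c2) => [->|xc2]; first by tauto.
  have [xm|xm] : x < m \/ m <= x by lia.
    have xam : a <= x < m by lia.
    have [? [? [? [? [? [? ?]]]]]] := V1 x xam xc1 xd1.
    have ? := g1E x xm xc1 xd1; have ? : g (g1 x) = x by rewrite g1E //; lia.
    by right; left; do !split.
  have xam : m <= x < b by lia.
  have [? [? [? [? [? [? ?]]]]]] := V2 x xam xc2 xd2.
  have ? := g2E x xm xc2 xd2; have ? : g (g2 x) = x by rewrite g2E //; lia.
  by right; right; do !split.
have pg : pairing a b g.
  move=> x xab; case: (gP x xab) => [[[[? ->]|[? ->]]|[[? ->]|[? ->]]]|]; try lia.
  case=> [] [? [? [-> [-> [? ?]]]]]; lia.
have ng : noncrossing a b g g.
  move=> x y xab yab xy; have := ng1 x y; have := ng2 x y.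
  have X := gP x xab; have Y := gP y yab.
  clear -X Y xy ac1 ac2 cd1 cd2 db1 db2.
  case: X => [[[[? ->]|[? ->]]|[[? ->]|[? ->]]]|[] [? [? [-> [_ [? [_ ?]]]]]]] ;
  (case: Y => [[[[? ->]|[? ->]]|[[? ->]|[? ->]]]|[] [? [? [-> [_ [? [_ ?]]]]]]]);
  try lia.
have F x : a <= x < b -> a <= x < m /\ (a <= f x < m /\
    ((x < c1 /\ f x < c1) \/ (c1 <= x <= d1 /\ c1 <= f x <= d1) \/
     (d1 < x /\ d1 < f x))) \/
  m <= x < b /\ (m <= f x < b /\
    ((x < c2 /\ f x < c2) \/ (c2 <= x <= d2 /\ c2 <= f x <= d2) \/
     (d2 < x /\ d2 < f x))).
  move=> xab; have [xm|xm] : a <= x < m \/ m <= x < b by lia.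
    by left; split=> //; apply: F1.
  by right; split=> //; apply: F2.
have nfg : noncrossing a b f g.
  move=> x y xab yab xy; have := nfg1 x y; have := nfg2 x y.
  have X := F x xab; have Y := gP y yab.
  clear -X Y xy ac1 ac2 cd1 cd2 db1 db2.
  case: X => [[? [? ?]]|[? [? ?]]];
  (case: Y => [[[[? ->]|[? ->]]|[[? ->]|[? ->]]]|[] [? [? [-> [_ [? [_ ?]]]]]]]); lia.
have df x : a <= x < b -> g x <> f x.
  move=> xab; have X := F x xab; have Y := gP x xab.
  clear -X Y ac1 ac2 cd1 cd2 db1 db2.
  by case: Y => [[[[? ->]|[? ->]]|[[? ->]|[? ->]]]|[] [? [? [-> [_ [? [? ?]]]]]]] //; lia.
exists g; split=> //; split=> //; [lia|by move=> *; apply: df|].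
move=> x xab; have X := F x xab; have Y := gP x xab.
clear -X Y ac1 ac2 cd1 cd2 db1 db2.
by case: Y => [[[[? ->]|[? ->]]|[[? ->]|[? ->]]]|[] [? [? [-> [_ [? [_ ?]]]]]]]; lia.
Qed.

(** The last conjunct says that this solution has no chord across [m], which distinguishes it from
    the rewired one of [presolves_cat]. *)
Lemma solves_cat a m b f g1 g2 : a <= m <= b ->
  pairing a m f -> pairing m b f ->
  solves a m f g1 -> solves m b f g2 ->
  exists g, solves a b f g /\ forall x, a <= x < m -> g x < m.
Proof.
move=> amb pf1 pf2 [[pg1 ng1] nfg1 df1] [[pg2 ng2] nfg2 df2].
exists (fun x => if x < m then g1 x else g2 x); split; last first.
  by move=> x xam; have := pg1 x; move=> *; split_ifs; lia.
split; first split.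
- by move=> x xab; have := pg1 x; have := pg2 x; move=> ? ?; split_ifs; lia.
- move=> x y xab yab; have := ng1 x y; have := ng2 x y.
  have := pg1 x; have := pg2 x; have := pg1 y; have := pg2 y.
  by move=> ? ? ? ? ? ?; split_ifs; lia.
- move=> x y xab yab; have := nfg1 x y; have := nfg2 x y.
  have := pf1 x; have := pf2 x; have := pg1 y; have := pg2 y.
  by move=> ? ? ? ? ? ?; split_ifs; lia.
- by move=> x xab; have := df1 x; have := df2 x; move=> *; split_ifs; lia.
Qed.

(** Two points admit only one matching, which shares its chord with [f]; this is the base case that
    forces the exceptional chord in [presolves]. *)
Lemma presolves_leaf a f : matches a (a + 2) f ->
  presolves a (a + 2) f f a (a + 1).
Proof.
move=> [pf nf]; have := pf a.
by split=> // [|x|x]; [lia|lia|have := pf x; lia].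
Qed.

(** The spanning chord of [f] is kept around the solution of the interior; nothing lies outside it,
    so it serves as the visible exceptional chord. *)
Lemma presolves_chord a b f g : a + 1 < b -> pairing a b f -> f a = b.-1 ->
  solves a.+1 b.-1 f g -> exists h, presolves a b f h a b.-1.
Proof.
move=> ab pf fa [[pg ng] nfg df].
pose h (x : nat) : nat := if x == a then b.-1 else if x == b.-1 then a else g x.
have hP x : a <= x < b ->
    x = a /\ h x = b.-1 \/ x = b.-1 /\ h x = a \/
    (h x = g x /\ h (g x) = x /\ a < x < b.-1 /\ a < g x < b.-1 /\ g x <> x /\ g x <> f x).
  move=> xab; have := pg x; have := df x; rewrite /h; split_ifs; lia.
have fb : f b.-1 = a by have := pf a; rewrite fa; lia.
exists h; split.
- split=> [x xab|x y xab yab].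
  + case: (hP x xab) => [[-> ->]|[[-> ->]|[-> ?]]]; try lia.
      by rewrite /h; split_ifs; lia.
    by rewrite /h; split_ifs; lia.
  + have := ng x y.
    by case: (hP x xab) => [[? ->]|[[? ->]|[-> ?]]];
    case: (hP y yab) => [[? ->]|[[? ->]|[-> ?]]]; lia.
- move=> x y xab yab; have := nfg x y.
  have [? [? ?]] := pf x xab.
  have ? : f x = b.-1 -> x = a by move=> E; have := pf x xab; rewrite E; lia.
  have ? : x = a -> f x = b.-1 by move=> ->.
  by case: (hP y yab) => [[? ->]|[[? ->]|[-> ?]]]; lia.
- by have := hP a; lia.
- by move=> x xab xa xb; case: (hP x xab); lia.
- by move=> x xab; lia.
Qed.

(** The visible chord [{c, d}] of the interior and the spanning chord are rewired into [{a, c}] and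
    [{d, b.-1}]. Neither is in [f], which joins [a] to [b.-1], and visibility of [{c, d}] prevents
    crossings. *)
Lemma solves_chord a b f g c d : a + 1 < b -> matches a b f -> f a = b.-1 ->
  presolves a.+1 b.-1 f g c d -> exists h, solves a b f h.
Proof.
move=> ab [pf nf] fa s.
have fb : f b.-1 = a by have := pf a; rewrite fa; lia.
have pf' : pairing a.+1 b.-1 f.
  move=> x xab; have := pf x; case: (f x =P a) => [E|]; first by rewrite E; lia.
  by case: (f x =P b.-1) => [E|]; [rewrite E; lia|lia].
have V x := @presolves_visible _ _ _ _ _ _ x pf' s.
have F x := @presolves_stable _ _ _ _ _ _ x pf' s.
case: s => [[pg ng] nfg [ac [cd [db gc]]] df _].
pose h (x : nat) : nat := if x == a then c else if x == c then a else
  if x == d then b.-1 else if x == b.-1 then d else g x.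
have hE x : x <> a -> x <> c -> x <> d -> x <> b.-1 -> h x = g x.
  by rewrite /h => *; split_ifs; lia.
have [ha hc hd hb] : [/\ h a = c, h c = a, h d = b.-1 & h b.-1 = d].
  by rewrite /h !eqxx; split=> //; split_ifs; lia.
clearbody h.
have hP x : a <= x < b ->
    ((x = a /\ h x = c \/ x = c /\ h x = a) \/
     (x = d /\ h x = b.-1 \/ x = b.-1 /\ h x = d)) \/
    (a < x < b.-1 /\ a < g x < b.-1 /\ h x = g x /\ h (g x) = x /\ g x <> x /\
     g x <> f x /\
     ((x < c /\ g x < c) \/ (c < x < d /\ c < g x < d) \/
      (d < x /\ d < g x))).
  move=> xab.
  case: (x =P a) => [->|xa]; first by tauto.
  case: (x =P c) => [->|xc]; first by tauto.
  case: (x =P d) => [->|xd]; first by tauto.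
  case: (x =P b.-1) => [->|xb]; first by tauto.
  have xab' : a < x < b.-1 by lia.
  have [? [? [? [? [? [? ?]]]]]] := V x xab' xc xd.
  have ? := hE x xa xc xd xb; have ? : h (g x) = x by rewrite hE //; lia.
  by right; do !split.
have fP x : a <= x < b -> (x = a /\ f x = b.-1 \/ x = b.-1 /\ f x = a) \/
    (a < x < b.-1 /\ a < f x < b.-1 /\
     ((x < c /\ f x < c) \/ (c <= x <= d /\ c <= f x <= d) \/
      (d < x /\ d < f x))).
  move=> xab.
  case: (x =P a) => [->|xa]; first by tauto.
  case: (x =P b.-1) => [->|xb]; first by tauto.
  by right; have xab' : a < x < b.-1; [lia|have := F x xab'].
exists h; split; first split.
- move=> x xab; have X := hP x xab; clear -X ha hb hc hd ac cd db ab.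
  by case: X => [[[[-> ->]|[-> ->]]|[[-> ->]|[-> ->]]]|[? [? [-> [-> ?]]]]]; lia.
- move=> x y xab yab xy; have := ng x y.
  have X := hP x xab; have Y := hP y yab; clear -X Y xy ac cd db.
  case: X => [[[[? ->]|[? ->]]|[[? ->]|[? ->]]]|[? [? [-> [_ [? [_ ?]]]]]]];
  (case: Y => [[[[? ->]|[? ->]]|[[? ->]|[? ->]]]|[? [? [-> [_ [? [_ ?]]]]]]]); lia.
- move=> x y xab yab xy; have := nfg x y.
  have X := fP x xab; have Y := hP y yab; clear -X Y xy ac cd db.
  case: X => [[[? ->]|[? ->]]|[? [? ?]]];
  (case: Y => [[[[? ->]|[? ->]]|[[? ->]|[? ->]]]|[? [? [-> [_ [? [_ ?]]]]]]]); lia.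
- move=> x xab; have X := fP x xab; have Y := hP x xab; clear -X Y ac cd db.
  by case: Y => [[[[? ->]|[? ->]]|[[? ->]|[? ->]]]|[? [? [-> [_ [? [? ?]]]]]]] //; lia.
Qed.

Lemma blockless_solvable a b f : matches a b f -> blockless a b f ->
  (a < b -> exists g c d, presolves a b f g c d) /\
  (a + 2 < b -> exists g, solves a b f g).
Proof.
have [n] := ubnP (b - a).
elim: n a b => // n IH a b ban mf bf.
case: (ltnP a b) => [ab|]; last by lia.
have [pf nf] := mf.
have [fa1 [fa2 fa3]] := pf a ltac:(lia).
have mf0 := @matches_inside a b f a mf ltac:(lia) ltac:(lia).
have bl c d : a <= c -> d <= b -> blockless c d f by move=> ? ? x ? ?; apply: bf; lia.
(* Either the chord at [a] spans the interval, or a nonempty closed interval follows it. *)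
have [fab|fab] : f a = b.-1 \/ (f a).+1 < b by lia.
- have [b2|b2] : b = a + 2 \/ a + 2 < b by lia.
    rewrite b2; split; last by lia.
    by exists f, a, (a + 1); apply: presolves_leaf; rewrite -b2.
  have mf' : matches a.+1 b.-1 f by rewrite -fab.
  have [i1 i2] := IH a.+1 b.-1 ltac:(lia) mf' (bl a.+1 b.-1 ltac:(lia) ltac:(lia)).
  (* The interior has an even, nonzero number of points, and exactly two of them would form a block
     with the spanning chord. *)
  have b4 : a.+1 + 2 < b.-1.
    have := matches_even mf'; have [p1 _] := mf'.
    by have := p1 (a + 1); have := bf a; lia.
  have [g sg] := i2 b4; have [h [c [d sh]]] := i1 ltac:(lia).
  split=> _.
    have [|h' ?] := presolves_chord _ pf fab sg; first by lia.
    by exists h', a, b.-1.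
  by apply: solves_chord mf fab sh; lia.
- have mf2 := matches_after ab mf.
  have mf1 : matches a (f a).+1 f.
    apply: matches_sub mf => [||x xa]; [by []|by lia|].
    have [-> //|[->|xl]] : x = a \/ x = f a \/ a < x < f a by lia.
      by lia.
      by rewrite fa2; lia.
    by have [p0 _] := mf0; have := p0 x; lia.
  have [i1 _] := IH a (f a).+1 ltac:(lia) mf1 (bl a (f a).+1 (leqnn a) ltac:(lia)).
  have [g1 [c1 [d1 s1]]] := i1 ltac:(lia).
  have [i2 _] := IH (f a).+1 b ltac:(lia) mf2 (bl (f a).+1 b ltac:(lia) (leqnn b)).
  have [g2 [c2 [d2 s2]]] := i2 fab.
  have [g [? _ ?]] := presolves_cat mf1.1 mf2.1 s1 s2.
  by split=> _; [exists g, c1, d2|exists g].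
Qed.

(** * Rotation and block removal *)

Definition unique_solution n (f : nat -> nat) : Prop :=
  exists g, solves 0 n f g /\
    forall h, solves 0 n f h -> forall x, x < n -> h x = g x.

(** Addition modulo [n] for [x < n] and [s <= n], written with a conditional to suit linear
    arithmetic. *)
Definition shift n s x := if x + s < n then x + s else x + s - n.

(** The matching read with point [s] relabelled as 0. *)
Definition rotf n s (f : nat -> nat) x := shift n (n - s) (f (shift n s x)).

Lemma shift_lt n s x : s <= n -> x < n -> shift n s x < n.
Proof. by rewrite /shift; split_ifs; lia. Qed.

Lemma shiftK n s x : s <= n -> x < n -> shift n (n - s) (shift n s x) = x.
Proof. by rewrite /shift => *; split_ifs; lia. Qed.

Lemma shift_subK n s x : s <= n -> x < n -> shift n s (shift n (n - s) x) = x.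
Proof. by rewrite /shift => *; split_ifs; lia. Qed.

Lemma shiftC n s t x : s <= n -> t <= n -> x < n ->
  shift n s (shift n t x) = shift n t (shift n s x).
Proof. by rewrite /shift => *; split_ifs; lia. Qed.

Lemma pairing_rot n s f : s <= n -> pairing 0 n f -> pairing 0 n (rotf n s f).
Proof.
move=> sn pf x xn; have sx := shift_lt sn xn.
have [fx [fxK fxx]] := pf _ sx.
rewrite {1 2 4}/rotf; split; first by rewrite /= shift_lt //; lia.
rewrite /rotf shift_subK // fxK shiftK //; split=> // E.
by apply: fxx; rewrite -[RHS](congr1 (shift n s) E) shift_subK.
Qed.

Lemma noncrossing_rot n s f g : s <= n -> pairing 0 n f -> pairing 0 n g ->
  noncrossing 0 n f g -> noncrossing 0 n (rotf n s f) (rotf n s g).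
Proof.
move=> sn pf pg nfg x y xn yn.
rewrite /rotf.
have sx := shift_lt sn xn; have sy := shift_lt sn yn.
have [fx [fxK fxx]] := pf _ sx.
have [gy [gyK gyy]] := pg _ sy.
(* Rotation may exchange the left and right ends of a chord, and the inside and outside of the
   interval below it, so the hypothesis is taken for each choice of ends of both chords. *)
have := nfg _ _ sx sy; have := nfg _ _ fx sy; have := nfg _ _ sx gy; have := nfg _ _ fx gy.
rewrite fxK gyK.
have : shift n s x = x + s /\ x + s < n \/ shift n s x + n = x + s.
  by rewrite /shift; split_ifs; lia.
have : shift n s y = y + s /\ y + s < n \/ shift n s y + n = y + s.
  by rewrite /shift; split_ifs; lia.
move: fx gy fxx gyy sx sy; clear fxK gyK; move: (f _) (g _) => A B.
move: (shift n s x) (shift n s y) => X Y fx gy fxx gyy sx sy.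
have : shift n (n - s) A + s = A + n /\ A < s \/ shift n (n - s) A + s = A /\ s <= A.
  by rewrite /shift; split_ifs; lia.
have : shift n (n - s) B + s = B + n /\ B < s \/ shift n (n - s) B + s = B /\ s <= B.
  by rewrite /shift; split_ifs; lia.
clear - sn sx sy fx gy fxx gyy xn yn.
move: (shift _ _ A) (shift _ _ B) => a b.
case=> [[? ?]|[? ?]]; case=> [[? ?]|[? ?]]; case=> [[? ?]|?]; case=> [[? ?]|?]; lia.
Qed.

Lemma matches_rot n s f : s <= n -> matches 0 n f -> matches 0 n (rotf n s f).
Proof. by move=> sn [pf nf]; split; [apply: pairing_rot|apply: noncrossing_rot]. Qed.

Lemma rotK n s f x : s <= n -> pairing 0 n f -> x < n ->
  rotf n (n - s) (rotf n s f) x = f x.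
Proof.
move=> sn pf xn; have [fx _] := pf x xn.
by rewrite /rotf subKn // shift_subK // shift_subK.
Qed.

Lemma rot_subK n s f x : s <= n -> pairing 0 n f -> x < n ->
  rotf n s (rotf n (n - s) f) x = f x.
Proof.
move=> sn pf xn; have [fx _] := pf x xn.
by rewrite /rotf subKn // !shiftK //.
Qed.

Lemma solves_rot n s f g : s <= n -> pairing 0 n f ->
  solves 0 n f g -> solves 0 n (rotf n s f) (rotf n s g).
Proof.
move=> sn pf [mg nfg df]; split; first exact: matches_rot.
  by apply: noncrossing_rot => //; case: mg.
move=> x xn E; have sx := shift_lt sn xn; apply: (df _ sx).
have := congr1 (shift n s) E; rewrite /rotf !shift_subK //.
  by have := pf _ sx; lia.
by case: mg => pg _; have := pg _ sx; lia.
Qed.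

Lemma solves_ext n f f' g : (forall x, x < n -> f x = f' x) ->
  solves 0 n f g -> solves 0 n f' g.
Proof.
move=> E [mg nfg df]; split=> // [x y xn yn|x xn].
  by rewrite -E //; apply: nfg.
by rewrite -E //; apply: df.
Qed.

Lemma unique_solution_ext n f f' : (forall x, x < n -> f x = f' x) ->
  unique_solution n f -> unique_solution n f'.
Proof.
move=> E [g [sg ug]]; exists g; split; first exact: solves_ext sg.
by move=> h sh; apply: ug; apply: solves_ext sh => x xn; rewrite E.
Qed.

Lemma unique_solution_rot n s f : s <= n -> pairing 0 n f ->
  unique_solution n f <-> unique_solution n (rotf n s f).
Proof.
have main t f' : t <= n -> pairing 0 n f' ->
    unique_solution n f' -> unique_solution n (rotf n t f').
  move=> tn pf' [g [sg ug]]; exists (rotf n t g); split; first exact: solves_rot.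
  move=> h sh x xn; have [[ph _] _ _] := sh.
  have s' : solves 0 n f' (rotf n (n - t) h).
    apply: (@solves_ext n (rotf n (n - t) (rotf n t f'))) => [y yn|].
      exact: rotK.
    by apply: solves_rot => //; [lia|apply: pairing_rot].
  rewrite -(rot_subK tn ph xn); congr (shift _ _ _).
  by apply: ug => //; apply: shift_lt.
move=> sn pf; split; first exact: main.
move/(main (n - s) _ (leq_subr s n) (pairing_rot sn pf)).
by apply: unique_solution_ext => x xn; apply: rotK.
Qed.

(** The outer chord of the block traps the partners of [m + 1] and [m + 2] among the four points,
    and they may not be joined to each other. The block occupies the last four points so that the
    others keep their labels. *)
Lemma solves_block m f g : pairing 0 m.+4 f -> f m = m + 3 -> f (m + 1) = m + 2 ->
  solves 0 m.+4 f g ->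
  [/\ g m = m + 1, g (m + 2) = m + 3 & forall x, x < m -> g x < m].
Proof.
move=> pf f0 f1 [[pg ng] nfg df].
have f2 : f (m + 2) = m + 1 by have := pf (m + 1); rewrite f1; lia.
have f3 : f (m + 3) = m by have := pf m; rewrite f0; lia.
have g1 : m <= g (m + 1) <= m + 3 by have := nfg m (m + 1); rewrite f0; lia.
have g2 : m <= g (m + 2) <= m + 3 by have := nfg m (m + 2); rewrite f0; lia.
have [g1n [g1K g1i]] := pg (m + 1) ltac:(lia).
have [g2n [g2K g2i]] := pg (m + 2) ltac:(lia).
have d1 := df (m + 1) ltac:(lia); have d2 := df (m + 2) ltac:(lia).
have e1 : g (m + 1) = m.
  (* If [m + 1] were joined to [m + 3], then [m + 2], trapped under that chord and not allowed
     [m + 1], would also need [m + 3]. *)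
  have [//|e1] : g (m + 1) = m \/ g (m + 1) = m + 3 by lia.
  have := ng (m + 1) (m + 2); rewrite e1 => N.
  have e2 : g (m + 2) = m + 3 by lia.
  by move: g1K g2K; rewrite e1 e2; lia.
have e2 : g (m + 2) = m + 3.
  have [e2|//] : g (m + 2) = m \/ g (m + 2) = m + 3 by lia.
  by move: g1K g2K; rewrite e1 e2; lia.
rewrite e1 in g1K; rewrite e2 in g2K; split=> // x xm.
have [gx [gxK gxx]] := pg x ltac:(lia).
have [//|[E|[E|[E|E]]]] : g x < m \/ g x = m \/ g x = m + 1 \/ g x = m + 2 \/ g x = m + 3 by lia.
all: by move: gxK; rewrite E; lia.
Qed.

Lemma pairing_block m f x : pairing 0 m.+4 f -> f m = m + 3 -> f (m + 1) = m + 2 ->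
  x < m -> f x < m.
Proof.
move=> pf f0 f1 xm.
have f2 : f (m + 2) = m + 1 by have := pf (m + 1); rewrite f1; lia.
have f3 : f (m + 3) = m by have := pf m; rewrite f0; lia.
have [fx [fxK fxx]] := pf x ltac:(lia).
have [//|[E|[E|[E|E]]]] : f x < m \/ f x = m \/ f x = m + 1 \/ f x = m + 2 \/ f x = m + 3 by lia.
all: by move: fxK; rewrite E; lia.
Qed.

Lemma solves_add_block m f g : pairing 0 m.+4 f -> f m = m + 3 -> f (m + 1) = m + 2 ->
  solves 0 m f g -> exists h, solves 0 m.+4 f h /\ forall x, x < m -> h x = g x.
Proof.
move=> pf f0 f1 [[pg ng] nfg df].
have f2 : f (m + 2) = m + 1 by have := pf (m + 1); rewrite f1; lia.
have f3 : f (m + 3) = m by have := pf m; rewrite f0; lia.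
have fm x := @pairing_block m f x pf f0 f1.
pose h (x : nat) : nat := if x < m then g x else if x == m then m + 1 else
  if x == m + 1 then m else if x == m + 2 then m + 3 else m + 2.
have hE x : x < m -> h x = g x by rewrite /h => ->.
have [h0 h1 h2 h3] : [/\ h m = m + 1, h (m + 1) = m, h (m + 2) = m + 3 & h (m + 3) = m + 2].
  by rewrite /h; split; split_ifs; lia.
clearbody h.
have hP x : x < m.+4 -> (x < m /\ g x < m /\ h x = g x /\ h (g x) = x /\ g x <> x /\ g x <> f x)
   \/ ((x = m /\ h x = m + 1 \/ x = m + 1 /\ h x = m) \/
       (x = m + 2 /\ h x = m + 3 \/ x = m + 3 /\ h x = m + 2)).
  move=> xm.
  have [lt|[->|[->|[->|->]]]] :
    x < m \/ x = m \/ x = m + 1 \/ x = m + 2 \/ x = m + 3 by lia.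
  - have [? [? ?]] := pg x lt; have ? := df x lt; have ? := hE x lt.
    by left; rewrite (hE (g x)).
  1-4: by right; rewrite ?h0 ?h1 ?h2 ?h3 ?f0 ?f1 ?f2 ?f3; clear; lia.
have fP x : x < m.+4 -> (x < m /\ f x < m) \/ ((x = m /\ f x = m + 3 \/ x = m + 1 /\ f x = m + 2)
   \/ (x = m + 2 /\ f x = m + 1 \/ x = m + 3 /\ f x = m)).
  move=> xm.
  have [lt|[->|[->|[->|->]]]] :
    x < m \/ x = m \/ x = m + 1 \/ x = m + 2 \/ x = m + 3 by lia.
  - by have := fm x lt; tauto.
  1-4: by right; rewrite ?h0 ?h1 ?h2 ?h3 ?f0 ?f1 ?f2 ?f3; clear; lia.
exists h; split=> //; split; first split.
- move=> x xn; have X := hP x xn; clear - X h0 h1 h2 h3.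
  by case: X => [[? [? [-> [-> ?]]]]|[[[-> ->]|[-> ->]]|[[-> ->]|[-> ->]]]]; lia.
- move=> x y xn yn xy; have X := hP x xn; have Y := hP y yn; have := ng x y; clear - X Y xy.
  case: X => [[? [? [-> [_ [? _]]]]]|[[[? ->]|[? ->]]|[[? ->]|[? ->]]]];
  (case: Y => [[? [? [-> [_ [? _]]]]]|[[[? ->]|[? ->]]|[[? ->]|[? ->]]]]); lia.
- move=> x y xn yn xy; have X := fP x xn; have Y := hP y yn; have := nfg x y; clear - X Y xy.
  case: X => [[? ?]|[[[? ->]|[? ->]]|[[? ->]|[? ->]]]];
  (case: Y => [[? [? [-> [_ [? _]]]]]|[[[? ->]|[? ->]]|[[? ->]|[? ->]]]]); lia.
- move=> x xn; have X := fP x xn; have Y := hP x xn; clear - X Y.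
  case: X => [[? ?]|[[[? ->]|[? ->]]|[[? ->]|[? ->]]]];
  (case: Y => [[? [? [-> [_ [? ?]]]]]|[[[? ->]|[? ->]]|[[? ->]|[? ->]]]]); lia.
Qed.

(** Restriction to the first [m] points and extension by [{m, m + 1}], [{m + 2, m + 3}] are inverse
    bijections between the two sets of solutions. *)
Lemma unique_solution_block m f : matches 0 m.+4 f -> f m = m + 3 -> f (m + 1) = m + 2 ->
  unique_solution m.+4 f <-> unique_solution m f.
Proof.
move=> [pf nf] f0 f1; have fm x := @pairing_block m f x pf f0 f1.
have down g : solves 0 m.+4 f g -> solves 0 m f g.
  move=> sg; have [g0 g2 gm] := solves_block pf f0 f1 sg.
  case: sg => [mg nfg df]; split.
  - by apply: matches_sub mg => [||x]; [by []|lia|have := gm x; lia].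
  - by move=> x y ? ?; apply: nfg; lia.
  - by move=> x ?; apply: df; lia.
split=> [[g [sg ug]]|[g [sg ug]]].
  exists g; split; first exact: down.
  move=> h sh x xm; have [h' [sh' <-//]] := solves_add_block pf f0 f1 sh.
  by apply: ug => //; lia.
have [h [sh hE]] := solves_add_block pf f0 f1 sg.
exists h; split=> // h' sh' x xm.
have [h0 h2 _] := solves_block pf f0 f1 sh.
have [h0' h2' _] := solves_block pf f0 f1 sh'.
case: sh => [[ph _] _ _]; case: sh' (down _ sh') => [[ph' _] _ _] sh'.
have := ph m ltac:(lia); have := ph (m + 2) ltac:(lia).
have := ph' m ltac:(lia); have := ph' (m + 2) ltac:(lia).
rewrite h0 h0' h2 h2' => [[_ [e1 _]] [_ [e2 _]] [_ [e3 _]] [_ [e4 _]]].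
have [lt|[->|[->|[->|->]]]] : x < m \/ x = m \/ x = m + 1 \/ x = m + 2 \/ x = m + 3 by lia.
- by rewrite hE //; apply: ug.
all: congruence.
Qed.

(** * Cyclic blocks and small cases *)

Definition has_block n f x := f x = shift n 3 x /\ f (shift n 1 x) = shift n 2 x.

Definition no_block n f := forall x, x < n -> ~ has_block n f x.

Lemma has_block_rot n s f x : 3 < n -> s <= n -> pairing 0 n f -> x < n ->
  has_block n (rotf n s f) x <-> has_block n f (shift n s x).
Proof.
move=> n3 sn pf xn; rewrite /has_block /rotf.
have sx t : t <= n -> shift n s (shift n t x) = shift n t (shift n s x).
  by move=> tn; apply: shiftC.
have inj y z : y < n -> z < n -> shift n (n - s) y = z <-> y = shift n s z.
  move=> yn zn; split=> [<-|->]; [by rewrite shift_subK|by rewrite shiftK].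
have fl y : y < n -> f y < n by move=> yn; have := pf y yn; lia.
rewrite !inj ?sx ?fl ?shift_lt //; lia.
Qed.

Lemma no_block_rot n s f : 3 < n -> s <= n -> pairing 0 n f ->
  no_block n f -> no_block n (rotf n s f).
Proof.
move=> n3 sn pf nb x xn /has_block_rot - /(_ n3 sn pf xn).
by apply: nb; apply: shift_lt.
Qed.

Lemma no_block_blockless n f : no_block n f -> blockless 0 n f.
Proof.
move=> nb x _ xn fx fx1; apply: (nb x); first by lia.
by rewrite /has_block /shift; split_ifs; lia.
Qed.

(* Rotation by x + 4 sends a block starting at [x] to the last four points. *)
Lemma unique_solution_rem_block m f x : x < m.+4 -> matches 0 m.+4 f ->
  has_block m.+4 f x ->
  let f' := rotf m.+4 (shift m.+4 4 x) f in
  [/\ f' m = m + 3, f' (m + 1) = m + 2, matches 0 m f' &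
      unique_solution m.+4 f <-> unique_solution m f'].
Proof.
move=> xn mf bx f'.
have sn : shift m.+4 4 x < m.+4 by apply: shift_lt.
have mf' : matches 0 m.+4 f' by apply: matches_rot => //; apply: ltnW.
have : has_block m.+4 f' m.
  have m4 : m < m.+4 by lia.
  apply/(has_block_rot _ (ltnW sn) mf.1 m4) => //.
  have -> // : shift m.+4 (shift m.+4 4 x) m = x.
  by rewrite /shift; split_ifs; lia.
rewrite /has_block; have -> : shift m.+4 3 m = m + 3 by rewrite /shift; split_ifs; lia.
have -> : shift m.+4 1 m = m + 1 by rewrite /shift; split_ifs; lia.
have -> : shift m.+4 2 m = m + 2 by rewrite /shift; split_ifs; lia.
move=> [e1 e2]; split=> //.
  apply: matches_sub mf' => // [|y ym]; first by lia.
  have := @pairing_block m f' y; have := matches_rot (ltnW sn) mf => -[pf' _]; auto.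
exact: iff_trans (unique_solution_rot (ltnW sn) mf.1) (unique_solution_block mf' e1 e2).
Qed.

(* Two solutions differ on whether some chord joins [0, l) and [l, n). *)
Lemma split_not_unique n l f : 4 <= l -> l + 4 <= n -> matches 0 n f ->
  blockless 0 n f -> (forall x, x < l -> f x < l) -> ~ unique_solution n f.
Proof.
move=> l4 ln mf bf cl [g [sg ug]].
have cl' x : l <= x < n -> l <= f x < n.
  case: mf => pf _ xn; have [fx [fxK _]] := pf x ltac:(lia).
  by have := cl (f x); rewrite fxK; lia.
have m1 : matches 0 l f.
  by apply: matches_sub mf => [||x]; [by []|lia|have := cl x; lia].
have m2 : matches l n f.
  by apply: matches_sub mf => [||x]; [by []|by []|have := cl' x; lia].
have b1 : blockless 0 l f by move=> x ? ?; apply: bf; lia.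
have b2 : blockless l n f by move=> x ? ?; apply: bf; lia.
have [p1 s1] := blockless_solvable m1 b1; have [p2 s2] := blockless_solvable m2 b2.
have [g1 [c1 [d1 p1']]] := p1 ltac:(lia); have [g2 [c2 [d2 p2']]] := p2 ltac:(lia).
have [h1 s1'] := s1 ltac:(lia); have [h2 s2'] := s2 ltac:(lia).
have [h [_ hd sh]] := presolves_cat m1.1 m2.1 p1' p2'.
have lln : 0 <= l <= n by lia.
have [k [sk kl]] := solves_cat lln m1.1 m2.1 s1' s2'.
case: p1' => _ _ [_ [_ [dl _]]] _ _; case: p2' => _ _ [lc _] _ _.
have := ug _ sh d1 ltac:(lia); have := ug _ sk d1 ltac:(lia); have := kl d1 ltac:(lia).
by rewrite hd; lia.
Qed.

Lemma no_block_not_unique n f : 8 <= n -> matches 0 n f -> no_block n f ->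
  ~ unique_solution n f.
Proof.
move=> n8 mf nb uf; have [pf nf] := mf.
suff [s [l [sn l4 ln cl]]] : exists s l, [/\ s <= n, 4 <= l, l + 4 <= n &
    forall x, x < l -> rotf n s f x < l].
  apply: (@split_not_unique n l (rotf n s f)) => //; first exact: matches_rot.
    by apply: no_block_blockless; apply: no_block_rot => //; lia.
  by rewrite -unique_solution_rot.
(* First case: some chord joins points that are not cyclically adjacent. It is rotated to start at
   0, and the cut is made right after its other end. *)
case: (boolP [exists i : 'I_n, (f i != shift n 1 i) && (shift n 1 (f i) != i :> nat)]).
  move=> /existsP [i /andP [/eqP i1 /eqP i2]]; have ilt := ltn_ord i.
  have sn : i <= n by lia.
  have nb' := @no_block_rot n i f ltac:(lia) sn pf nb.
  have [pf' nf'] := matches_rot sn mf.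
  have e0 : rotf n i f 0 = shift n (n - i) (f i).
    by rewrite /rotf; congr (shift _ _ (f _)); rewrite /shift; split_ifs; lia.
  have [fi _] := pf i ltac:(lia).
  have j1 : rotf n i f 0 <> 1 by move: i1 i2; rewrite e0 /shift; split_ifs; lia.
  have j2 : rotf n i f 0 <> n.-1 by move: i1 i2; rewrite e0 /shift; split_ifs; lia.
  have [h hE] : exists h, h = rotf n i f by exists (rotf n i f).
  move: pf' nf' nb' j1 j2; rewrite -hE => ph nh nbh j1 j2 {e0}.
  have mh : matches 0 n h by [].
  have [h0 [h0K h00]] := ph 0 ltac:(lia).
  have cl x : x < (h 0).+1 -> h x < (h 0).+1.
    move=> xl; have [-> //|[->|xl']] : x = 0 \/ x = h 0 \/ 0 < x < h 0 by lia.
      by rewrite h0K.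
    by have := nh 0 x; lia.
  have cl' x : h 0 < x < n -> h 0 < h x < n.
    by move=> xl; have := cl (h x); have := ph x; lia.
  exists i, (h 0).+1; rewrite -hE; split=> //.
    by have := @matches_odd 0 n h 0 mh; lia.
  have oddh0 : odd (h 0) by have := @matches_odd 0 n h 0 mh; lia.
  have evenn : ~~ odd n by have := matches_even mh; lia.
  (* By parity the outer part has two points or at least four; two points would form, with the
     chord, a block wrapping past the end. *)
  have [E|] : n = h 0 + 3 \/ (h 0).+1 + 4 <= n by lia.
    have := nbh (h 0) ltac:(lia); rewrite /has_block h0K.
    have -> : shift n 3 (h 0) = 0 by rewrite /shift; split_ifs; lia.
    have -> : shift n 1 (h 0) = h 0 + 1 by rewrite /shift; split_ifs; lia.
    have -> : shift n 2 (h 0) = h 0 + 2 by rewrite /shift; split_ifs; lia.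
    by have := ph (h 0 + 1); have := cl' (h 0 + 1); lia.
  by [].
(* Second case: all chords join neighbours, so the matching is a ring, and any two consecutive
   chords make up a part of four points. *)
move=> /existsPn adj.
have {}adj x : x < n -> f x = shift n 1 x \/ shift n 1 (f x) = x.
  move=> xn; have := adj (Ordinal xn); rewrite negb_and !negbK /=.
  by case/orP => /eqP; tauto.
have {adj} adj x : x < n ->
    f x = x + 1 \/ f x + 1 = x \/ (x = 0 /\ f x = n.-1) \/ (x = n.-1 /\ f x = 0).
  move=> xn; have := pf x xn; have := adj x xn; rewrite /shift; split_ifs; lia.
have [E|E] : f 0 = 1 \/ f 0 = n.-1 by have := adj 0; lia.
  exists 0, 4; split; try lia.
  move=> x x4; have -> : rotf n 0 f x = f x.
    rewrite /rotf subn0; have -> : shift n 0 x = x by rewrite /shift; split_ifs; lia.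
    by have := pf x; rewrite /shift; split_ifs; lia.
  have f1 : f 1 = 0 by have := pf 0; rewrite E; lia.
  have f2 : f 2 = 3 by have := adj 2; have := pf 2; case: (f 2 =P 1) => [->|]; lia.
  have f3 : f 3 = 2 by have := pf 2; rewrite f2; lia.
  by case: x x4 => [|[|[|[|x]]]] // _; rewrite ?E ?f1 ?f2 ?f3.
(* The chord at 0 wraps around to [n.-1], so rotation by one aligns the chords [{1, 2}] and [{3, 4}]
   with the first four labels. *)
exists 1, 4; split; try lia.
move=> x x4; have -> : rotf n 1 f x = f x.+1 - 1.
  rewrite /rotf; have -> : shift n 1 x = x.+1 by rewrite /shift; split_ifs; lia.
  have [fx [fxK _]] := pf x.+1 ltac:(lia).
  have : f x.+1 <> 0 by move=> e; move: fxK; rewrite e E; lia.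
  by rewrite /shift; split_ifs; lia.
have f1 : f 1 = 2.
  by have := adj 1; have := pf 1; case: (f 1 =P 0) => [->|]; lia.
have f2 : f 2 = 1 by have := pf 1; rewrite f1; lia.
have f3 : f 3 = 4 by have := adj 3; have := pf 3; case: (f 3 =P 2) => [->|]; lia.
have f4 : f 4 = 3 by have := pf 3; rewrite f3; lia.
by case: x x4 => [|[|[|[|x]]]] // _; rewrite ?f1 ?f2 ?f3 ?f4.
Qed.

(** * Matchings of size at most three *)

Lemma unique_solution0 f : unique_solution 0 f.
Proof. by exists id; split=> //; split=> //; split. Qed.

Lemma not_unique_solution2 f : matches 0 2 f -> ~ unique_solution 2 f.
Proof.
move=> [pf _] [g [[[pg _] _ df] _]].
by have := pf 0 isT; have := pg 0 isT; have := df 0 isT; lia.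
Qed.

Lemma matches4_cases f : matches 0 4 f -> f 0 = 1 /\ f 2 = 3 \/ f 0 = 3 /\ f 1 = 2.
Proof.
move=> [pf nf].
have p0 := pf 0 isT; have p1 := pf 1 isT; have p2 := pf 2 isT; have p3 := pf 3 isT.
have n0 := nf 0 1 isT isT isT.
have [E|[E|[E|E]]] : f 0 = 1 \/ f 0 = 2 \/ f 0 = 3 \/ ~ (1 <= f 0 <= 3) by lia.
- rewrite E in p0 n0; left; split=> //.
  have [e|[e|//]] : f 2 = 0 \/ f 2 = 1 \/ f 2 = 3 by lia.
    by rewrite e in p2; lia.
  by rewrite e in p2; lia.
- rewrite E in p0 n0; case: (f 1 =P 0) => e; first by rewrite e in p1; lia.
  by case: (f 1 =P 2) => e2; [rewrite e2 in p1|]; lia.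
- rewrite E in p0 n0; right; split=> //.
  have [e|[e|[e|//]]] : f 1 = 0 \/ f 1 = 1 \/ f 1 = 3 \/ f 1 = 2 by lia.
    by rewrite e in p1; lia.
    by lia.
  by rewrite e in p1; lia.
- lia.
Qed.

(** Cyclically, both matchings of four points are blocks, and removing the block leaves the empty
    matching with its single solution. *)
Lemma matches4_unique f : matches 0 4 f -> unique_solution 4 f.
Proof.
move=> mf; have [pf _] := mf.
have p0 := pf 0 isT; have p1 := pf 1 isT; have p2 := pf 2 isT; have p3 := pf 3 isT.
have [x x4 bx] : exists2 x, x < 4 & has_block 4 f x.
  case: (matches4_cases mf) => [[e0 e2]|[e0 e1]].
    exists 3 => //; rewrite e2 in p2.
    by split; [change (f 3 = 2); lia|change (f 0 = 1)].
  by exists 0.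
by have [_ _ _ ->] := @unique_solution_rem_block 0 f x x4 mf bx; apply: unique_solution0.
Qed.

Definition ringA_fun x := if odd x then x.-1 else x.+1.
Definition ringB_fun n x :=
  if odd x then (if x.+1 == n then 0 else x.+1) else (if x == 0 then n.-1 else x.-1).


Lemma pairing_ringA n : ~~ odd n -> pairing 0 n ringA_fun.
Proof. by move=> en x xn; rewrite /ringA_fun; split_ifs; lia. Qed.

(** Lets the second ring inherit uniqueness from the first by rotation. *)
Lemma ringB6 x : x < 6 -> rotf 6 1 ringA_fun x = ringB_fun 6 x.
Proof. by case: x => [|[|[|[|[|[|x]]]]]]. Qed.

Lemma matches6_values f : matches 0 6 f ->
  [/\ forall x, x < 6 -> ~~ odd x -> [\/ f x = 1, f x = 3 | f x = 5],
      forall x, x < 6 -> odd x -> [\/ f x = 0, f x = 2 | f x = 4] &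
      forall x y, x < 6 -> y < 6 -> f x = y -> f y = x].
Proof.
move=> mf; have [pf _] := mf; split=> x.
- move=> x6 ox; have := pf x x6; have := matches_odd mf x6; rewrite ox.
  by case: (f x) => [|[|[|[|[|[|k]]]]]] //= _ []; constructor.
- move=> x6 ox; have := pf x x6; have := matches_odd mf x6; rewrite ox.
  by case: (f x) => [|[|[|[|[|[|k]]]]]] //= _ []; constructor.
- by move=> y x6 _ <-; have [_ []] := pf x x6.
Qed.

(** The only solution is the other ring. Parity leaves three possible partners for each point, and
    disjointness from [ringA_fun] removes one of them. *)
Lemma unique_solution_ringA6 : unique_solution 6 ringA_fun.
Proof.
exists (ringB_fun 6); split.
  split; first split.
  - by case=> [|[|[|[|[|[|x]]]]]].
  - by case=> [|[|[|[|[|[|x]]]]]] [|[|[|[|[|[|y]]]]]].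
  - by case=> [|[|[|[|[|[|x]]]]]] [|[|[|[|[|[|y]]]]]].
  - by case=> [|[|[|[|[|[|x]]]]]].
move=> h [mh _ dh]; have [even_h odd_h inv] := matches6_values mh.
have d0 : h 0 <> 1 := dh 0 isT; have d2 : h 2 <> 3 := dh 2 isT.
have d4 : h 4 <> 5 := dh 4 isT; have [_ nh] := mh.
have h0 : h 0 = 5.
  have [//|e0|//] := even_h 0 isT isT.
  have n43 := inv 0 3 isT isT e0.
  have [e|e|//] := even_h 4 isT isT.
    by have := nh 0 1 isT isT isT; rewrite e0 (inv 4 1 isT isT e) => /(_ isT).
  by have := inv 4 3 isT isT e; rewrite n43.
have h5 := inv 0 5 isT isT h0.
have h1 : h 1 = 2.
  have [e|//|e] := odd_h 1 isT isT; first by have := inv 1 0 isT isT e; rewrite h0.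
  (* If 1 were joined to 4, then 2 would have no partner: 1 and 5 are taken and 3 is forbidden. *)
  have h4 := inv 1 4 isT isT e.
  have [e2|//|e2] := even_h 2 isT isT; first by have := inv 2 1 isT isT e2; rewrite e.
  by have := inv 2 5 isT isT e2; rewrite h5.
have h2 := inv 1 2 isT isT h1.
have h3 : h 3 = 4.
  have [e|e|//] := odd_h 3 isT isT.
    by have := inv 3 0 isT isT e; rewrite h0.
  by have := inv 3 2 isT isT e; rewrite h2.
have h4 := inv 3 4 isT isT h3.
by case=> [|[|[|[|[|[|x]]]]]].
Qed.

Lemma unique_solution_ring6 f :
  (forall x, x < 6 -> f x = ringA_fun x) \/ (forall x, x < 6 -> f x = ringB_fun 6 x) ->
  unique_solution 6 f.
Proof.
case=> E; first by apply: unique_solution_ext unique_solution_ringA6 => x x6; rewrite E.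
apply: (@unique_solution_ext 6 (rotf 6 1 ringA_fun)) => [x x6|].
  by rewrite E // ringB6.
by rewrite -unique_solution_rot //; [apply: unique_solution_ringA6|apply: pairing_ringA].
Qed.

(** The three matchings of six points that are not rings contain a diameter, and it forms a block
    with a short chord beside it. *)
Lemma no_block6_ring f : matches 0 6 f -> no_block 6 f ->
  (forall x, x < 6 -> f x = ringA_fun x) \/ (forall x, x < 6 -> f x = ringB_fun 6 x).
Proof.
move=> mf nb; have [_ nf] := mf.
have [even_f odd_f inv] := matches6_values mf.
have [e0|e0|e0] := even_f 0 isT isT; have e0' := inv 0 _ isT _ e0.
- left; have e1 := e0' isT.
  have e2 : f 2 = 3.
    have [e|//|e] := even_f 2 isT isT; first by have := inv 2 1 isT isT e; rewrite e1.
    have e5 := inv 2 5 isT isT e.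
    have [e3|e3|e3] := odd_f 3 isT isT.
    + by have := inv 3 0 isT isT e3; rewrite e0.
    + by have := inv 3 2 isT isT e3; rewrite e.
    + by case: (nb 2).
  have e3 := inv 2 3 isT isT e2.
  have e4 : f 4 = 5.
    have [e|e|//] := even_f 4 isT isT.
      by have := inv 4 1 isT isT e; rewrite e1.
    by have := inv 4 3 isT isT e; rewrite e3.
  have e5 := inv 4 5 isT isT e4.
  by case=> [|[|[|[|[|[|x]]]]]].
- have e3 := e0' isT; have n1 := nf 0 1 isT isT isT.
  have [e|e|e] := odd_f 1 isT isT.
  + by have := inv 1 0 isT isT e; rewrite e0.
  + by case: (nb 0).
  + by move: n1; rewrite e0 e => /(_ isT).
- right; have e5 := e0' isT.
  have e1 : f 1 = 2.
    have [e|//|e] := odd_f 1 isT isT; first by have := inv 1 0 isT isT e; rewrite e0.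
    have e4 := inv 1 4 isT isT e.
    have [e2|e2|e2] := even_f 2 isT isT.
    + by have := inv 2 1 isT isT e2; rewrite e.
    + by case: (nb 1).
    + by have := inv 2 5 isT isT e2; rewrite e5.
  have e2 := inv 1 2 isT isT e1.
  have e3 : f 3 = 4.
    have [e|e|//] := odd_f 3 isT isT.
      by have := inv 3 0 isT isT e; rewrite e0.
    by have := inv 3 2 isT isT e; rewrite e2.
  have e4 := inv 3 4 isT isT e3.
  by case=> [|[|[|[|[|[|x]]]]]].
Qed.

(** * From sets of edges to involutions *)

Definition represents n (M : {set {set 'I_n}}) (f : nat -> nat) : Prop :=
  forall e, e \in M <-> exists x y : 'I_n, f x = y /\ e = [set x; y].

Lemma set2_eq (T : finType) (a b c d : T) : [set a; b] = [set c; d] ->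
  a = c /\ b = d \/ a = d /\ b = c.
Proof.
move=> /setP E; have := E a; have := E b; have := E c; have := E d.
rewrite !inE !eqxx ?orbT /= => /orP h1 /orP h2 /esym/orP h3 /esym/orP h4.
by case: h1 h2 h3 h4 => /eqP ? [] /eqP ? [] /eqP ? [] /eqP ?; subst; tauto.
Qed.

Lemma edge_represents n (M : {set {set 'I_n}}) f (a b : 'I_n) :
  represents M f -> pairing 0 n f -> [set a; b] \in M <-> f a = b.
Proof.
move=> R pf; split=> [/R [x [y [fx /set2_eq]]]|fa]; last by apply/R; exists a, b.
case=> [[-> ->] //|[-> ->]]; rewrite -fx.
by have [_ []] := pf x (ltn_ord x).
Qed.

Lemma represents_ext n (M : {set {set 'I_n}}) f g :
  (forall x, x < n -> f x = g x) -> represents M f -> represents M g.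
Proof.
by move=> E R e; split=> [/R|] [x [y [fx ->]]]; [|apply/R]; exists x, y; split=> //;
  rewrite -fx E.
Qed.

Lemma represents_inj n (M N : {set {set 'I_n}}) f :
  represents M f -> represents N f -> M = N.
Proof. by move=> RM RN; apply/setP => e; apply/idP/idP => [/RM/RN|/RN/RM]. Qed.

Lemma represents_fun_inj n (M : {set {set 'I_n}}) f g :
  represents M f -> represents M g -> pairing 0 n f -> pairing 0 n g ->
  forall x, x < n -> f x = g x.
Proof.
move=> Rf Rg pf pg x xn; have [fxn _] := pf x xn.
apply/esym; apply/(edge_represents (Ordinal xn) (Ordinal (fxn : f x < n)) Rg pg).
by apply/(edge_represents _ _ Rf pf).
Qed.

(** The two disjuncts of [cross] match the two ways of violating the bounds in [noncrossing]: the
    far end of the chord of [g] falls right of the chord of [f] or left of it. *)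
Lemma noncrossing_represents n (M N : {set {set 'I_n}}) f g :
  represents M f -> represents N g -> pairing 0 n f -> pairing 0 n g ->
  [forall e in M, forall e' in N, ~~ cross e e'] <-> noncrossing 0 n f g.
Proof.
move=> Rf Rg pf pg; split.
  move=> /forallP nc x y xn yn xy yfx.
  have [fxn [fxK _]] := pf x xn; have [gyn [gyK _]] := pg y yn.
  pose x1 := Ordinal (xn : x < n); pose x2 := Ordinal (fxn : f x < n).
  pose y1 := Ordinal (yn : y < n); pose y2 := Ordinal (gyn : g y < n).
  have xM : [set x1; x2] \in M by apply/(edge_represents _ _ Rf pf).
  have yN : [set y1; y2] \in N by apply/(edge_represents _ _ Rg pg).
  have := nc [set x1; x2]; rewrite xM /= => /forallP/(_ [set y1; y2]); rewrite yN /=.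
  rewrite /cross negb_or => /andP [c1 c2]; apply/andP; split; rewrite leqNgt.
    apply: contra c2 => lt; apply/existsP; exists y2; apply/existsP; exists y1.
    apply/existsP; exists x1; apply/existsP; exists x2.
    by rewrite setUC !eqxx /= lt xy yfx.
  apply: contra c1 => lt; apply/existsP; exists x1; apply/existsP; exists x2.
  apply/existsP; exists y1; apply/existsP; exists y2.
  by rewrite !eqxx /= lt xy yfx.
move=> nc; apply/forallP => e; apply/implyP => eM; apply/forallP => e'; apply/implyP => eN.
apply/norP; split; apply/negP => /existsP [a] /existsP [b] /existsP [c] /existsP [d]
  /and5P [/eqP E /eqP E' ac cb bd]; subst e e'.
  move/(edge_represents _ _ Rf pf): eM => fa; move/(edge_represents _ _ Rg pg): eN => gc.
  by have := nc a c (ltn_ord a) (ltn_ord c) ac; rewrite fa gc => /(_ cb); lia.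
(* Here the chord of [N] starts first, so its right end [b] is the point inside the chord of [M]. *)
move/(edge_represents _ _ Rf pf): eM => fc; move/(edge_represents _ _ Rg pg): eN => ga.
have := nc c b (ltn_ord c) (ltn_ord b) cb; rewrite fc => /(_ bd).
have [_ [gb _]] := pg a (ltn_ord a); move: gb; rewrite ga => ->; lia.
Qed.

Lemma disjoint_represents n (M N : {set {set 'I_n}}) f g :
  represents M f -> represents N g -> pairing 0 n f -> pairing 0 n g ->
  M :&: N == set0 <-> forall x, 0 <= x < n -> g x <> f x.
Proof.
move=> Rf Rg pf pg; split.
  move=> /eqP/setP dis x xn E; have [fxn _] := pf x xn.
  pose a := Ordinal (xn : x < n); pose b := Ordinal (fxn : f x < n).
  have := dis [set a; b]; rewrite !inE.
  have /(edge_represents _ _ Rf pf) -> : f a = b by [].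
  by have /(edge_represents _ _ Rg pg) -> : g a = b by [].
move=> df; apply/eqP/setP => e; rewrite !inE; apply/negP => /andP [/Rf [x [y [fx ->]]]].
by move/(edge_represents _ _ Rg pg); rewrite -fx => /df; apply; apply: ltn_ord.
Qed.

Lemma represents_matching n (M : {set {set 'I_n}}) f :
  represents M f -> matches 0 n f -> is_matching M.
Proof.
move=> R [pf nf]; apply/and3P; split; last by apply/(noncrossing_represents R R pf pf).
  apply/forallP => e; apply/implyP => /R [x [y [fx ->]]]; rewrite cards2.
  by have [_ [_]] := pf x (ltn_ord x); rewrite fx; case: (x =P y) => [->|].
apply/forallP => x; have [fxn _] := pf x (ltn_ord x).
apply/cards1P; exists [set x; Ordinal (fxn : f x < n)]; apply/setP => e; rewrite !inE.
apply/andP/eqP => [[/R [y [z [fy ->]]]]|->]; last first.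
  by rewrite !inE eqxx; split=> //; apply/(edge_represents _ _ R pf).
rewrite !inE => /orP [/eqP E|/eqP E]; subst x.
  by congr [set _; _]; apply: val_inj.
rewrite setUC; congr [set _; _]; apply: val_inj => /=.
by rewrite -fy; have [_ [-> _]] := pf y (ltn_ord y).
Qed.

Lemma matching_represented n (M : {set {set 'I_n}}) :
  is_matching M -> exists f, matches 0 n f /\ represents M f.
Proof.
move=> /and3P [/forallP c2 /forallP c1 nc].
have ex (x : 'I_n) : exists y : 'I_n, (y != x) && ([set x; y] \in M).
  have /cards1P [e /setP /(_ e)] := c1 x; rewrite !inE eqxx => /andP [eM xe].
  have /implyP /(_ eM) /cards2P [a [b [ab E]]] := c2 e; subst e.
  move: xe; rewrite !inE => /orP [] /eqP ->.
    by exists b; apply/andP; rewrite eq_sym.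
  by exists a; apply/andP; rewrite setUC.
have un (x y z : 'I_n) : y != x -> z != x -> [set x; y] \in M -> [set x; z] \in M -> y = z.
  move=> yx zx yM zM; have /cards1P [e /setP E] := c1 x.
  have := E [set x; y]; have := E [set x; z]; rewrite !inE yM zM !eqxx /=.
  move=> /esym/eqP <- /esym/eqP /set2_eq; case=> [[_ ->] //|[-> ->] //].
pose F (x : 'I_n) := xchoose (ex x).
have FP x : F x != x /\ [set x; F x] \in M by apply/andP/(xchooseP (ex x)).
(* The value 0 outside the range is arbitrary: all the predicates on [f] look only at arguments
   below [n]. *)
pose f (x : nat) : nat := if insub x is Some i then val (F i) else 0.
have fE (x : 'I_n) : f x = F x by rewrite /f valK.
have FK x : F (F x) = x.
  have [h1 h2] := FP x; have [h3 h4] := FP (F x).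
  by apply: (un (F x)) => //; [rewrite eq_sym|rewrite setUC].
have pf : pairing 0 n f.
  move=> x xn; rewrite -[x]/(val (Ordinal (xn : x < n))) !fE FK; split; first exact: ltn_ord.
  by split=> // /val_inj E; have [] := FP (Ordinal (xn : x < n)); rewrite E eqxx.
have R : represents M f.
  move=> e; split=> [eM|[x [y [fx ->]]]].
    have /implyP /(_ eM) /cards2P [a [b [ab E]]] := c2 e; subst e.
    exists a, b; split=> //; rewrite fE; congr val.
    by have [h1 h2] := FP a; apply: (un a) => //; rewrite eq_sym.
  have -> : y = F x by apply: val_inj; rewrite /= -fx fE.
  by have [] := FP x.
by exists f; split=> //; split=> //; apply/(noncrossing_represents R R pf pf).
Qed.

Lemma matches_represented n f : matches 0 n f ->
  exists M : {set {set 'I_n}}, represents M f.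
Proof.
move=> mf; exists [set e | [exists x : 'I_n, exists y : 'I_n, (f x == y) && (e == [set x; y])]].
move=> e; rewrite inE; split.
  by move=> /existsP [x] /existsP [y] /andP [/eqP ? /eqP ?]; exists x, y.
move=> [x [y [fx ->]]]; apply/existsP; exists x; apply/existsP; exists y.
by rewrite fx !eqxx.
Qed.

Lemma dcompat_solves n (M N : {set {set 'I_n}}) f g :
  represents M f -> represents N g -> matches 0 n f -> matches 0 n g ->
  dcompat M N <-> solves 0 n f g.
Proof.
move=> Rf Rg mf mg; rewrite /dcompat.
have := disjoint_represents Rf Rg mf.1 mg.1; have := noncrossing_represents Rf Rg mf.1 mg.1.
move=> h1 h2; split=> [/andP [/h2 ? /h1 ?]|[_ /h1 ? /h2 ?]]; first by split.
by apply/andP.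
Qed.

(** Compatible matchings correspond to solutions up to values at arguments [n] and above, hence the
    pointwise uniqueness in [unique_solution]. *)
Lemma degree1_unique n (M : {set {set 'I_n}}) f :
  represents M f -> matches 0 n f -> dcm_degree M = 1 <-> unique_solution n f.
Proof.
move=> R mf; rewrite /dcm_degree; split=> [/eqP/cards1P [N /setP SE]|[g [sg ug]]].
  have := SE N; rewrite !inE eqxx => /andP [/matching_represented [g [mg Rg]] dN].
  exists g; split; first by apply/(dcompat_solves R Rg mf mg).
  move=> h sh; have [mh _ _] := sh; have [N' Rh] := matches_represented mh.
  have := SE N'; rewrite !inE (represents_matching Rh mh).
  have /(dcompat_solves R Rh mf mh) -> := sh => /= /esym /eqP E; subst N'.
  exact: (represents_fun_inj Rh Rg mh.1 mg.1).
have [mg _ _] := sg; have [N Rg] := matches_represented mg.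
apply/eqP/cards1P; exists N; apply/setP => N'; rewrite !inE.
apply/andP/eqP => [[/matching_represented [h [mh Rh]] dN]|->].
  apply: (represents_inj _ Rg); apply: (represents_ext _ Rh).
  by apply: ug; apply/(dcompat_solves R Rh mf mh).
by split; [apply: represents_matching Rg mg|apply/(dcompat_solves R Rg mf mg)].
Qed.

(** * Removed blocks and relabelling *)

Lemma modn_shift n s x : s <= n -> x < n -> (x + s) %% n = shift n s x.
Proof.
move=> sn xn; rewrite /shift; case: ltnP => lt; first exact: modn_small.
by rewrite -{1}(subnK lt) modnDr modn_small //; lia.
Qed.

Lemma val_addo n (i : 'I_n) j : addo i j = (i + j) %% n :> nat.
Proof.
elim: j => [|j IH]; first by rewrite addn0 modn_small.
by rewrite /addo /= -/(addo i j) IH -addn1 modnDml addn1 addnS.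
Qed.

Lemma is_block_has_block n (M : {set {set 'I_n}}) f (i : 'I_n) : 3 < n ->
  represents M f -> pairing 0 n f -> is_block M i <-> has_block n f i.
Proof.
move=> n3 R pf; rewrite /is_block /blockK /has_block.
rewrite -!modn_shift ?(ltn_ord i) //; try lia.
rewrite -!val_addo -(edge_represents _ _ R pf) -(edge_represents _ _ R pf).
rewrite subUset !sub1set; split; first by move/andP.
by move=> ?; apply/andP.
Qed.

(** The relabelling is the rotation sending [i + 4] to 0; the block therefore gets the last four
    labels. *)
Lemma relab_shift n (i p : 'I_n) : 3 < n ->
  relab i p = shift n (n - shift n 4 i) p.
Proof.
move=> n3; have sn := shift_lt n3 (ltn_ord i).
rewrite /relab modn_shift // -(@modn_shift n (n - shift n 4 i) p) ?leq_subr //.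
by rewrite addnBA // ltnW.
Qed.

Lemma relab_image n (i : 'I_n) (p q : 'I_n) (x y : 'I_(n - 4)) :
  relab i p = x -> relab i q = y ->
  [set z : 'I_(n - 4) | [exists r, (r \in [set p; q]) && (relab i r == z)]] = [set x; y].
Proof.
move=> px qy; apply/setP => z; rewrite !inE; apply/existsP/orP.
  by move=> [r]; rewrite !inE => /andP [/orP [] /eqP -> /eqP E]; [left|right];
    apply/eqP/val_inj; rewrite /= -E ?px ?qy.
by case=> /eqP ->; [exists p; rewrite px|exists q; rewrite qy]; rewrite !inE !eqxx ?orbT.
Qed.

Lemma relab_block n (i p : 'I_n) j : 3 < n -> j < 4 -> p = addo i j ->
  relab i p = n - 4 + j.
Proof.
move=> n3 j4 ->; rewrite relab_shift // val_addo modn_shift; [|lia|exact: ltn_ord].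
by have := ltn_ord i; rewrite /shift; split_ifs; lia.
Qed.

Lemma remove_block_rotf n f x : 3 < n -> x < n -> matches 0 n f -> has_block n f x ->
  let f' := rotf n (shift n 4 x) f in
  matches 0 (n - 4) f' /\ (unique_solution n f <-> unique_solution (n - 4) f').
Proof.
move=> n3; have : n = (n - 4).+4 by lia.
move: (n - 4) => m nm; subst n => xn mf bx.
by have [_ _] := unique_solution_rem_block xn mf bx.
Qed.

(** The relabelling conjugates [f] to its rotation, and block edges are exactly those with labels
    from [n - 4] on, so the remaining edges are the chords of the rotated involution below
    [n - 4]. *)
Lemma remove_block_represents n (M : {set {set 'I_n}}) f (i : 'I_n) : 3 < n ->
  represents M f -> matches 0 n f -> is_block M i ->
  represents (remove_block M i) (rotf n (shift n 4 i) f).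
Proof.
move=> n3 R mf bi; have [pf _] := mf.
have hb : has_block n f i by apply/(is_block_has_block _ n3 R pf).
have [[pf' _] _] := remove_block_rotf n3 (ltn_ord i) mf hb.
have sn := ltnW (shift_lt n3 (ltn_ord i)).
have relf (p q : 'I_n) : f p = q -> relab i q = rotf n (shift n 4 i) f (relab i p).
  by move=> fp; rewrite !relab_shift // /rotf shift_subK ?fp.
have inK (p q : 'I_n) : [set p; q] \in blockK i -> n - 4 <= relab i p.
  rewrite /blockK !inE => /orP [] /eqP /set2_eq; case=> [[E _]|[E _]].
  - by rewrite (relab_block (j := 0) n3 isT E); lia.
  - by rewrite (relab_block (j := 3) n3 isT E); lia.
  - by rewrite (relab_block (j := 1) n3 isT E); lia.
  - by rewrite (relab_block (j := 2) n3 isT E); lia.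
have notK (p : 'I_n) : n - 4 <= relab i p -> exists2 j, j < 4 & p = addo i j.
  rewrite relab_shift // => le.
  have lt := @shift_lt n (n - shift n 4 i) p (leq_subr _ _) (ltn_ord p).
  exists (shift n (n - shift n 4 i) p - (n - 4)); first by lia.
  apply: val_inj; rewrite /= val_addo modn_shift ?ltn_ord //; last by lia.
  move: le lt; have := ltn_ord i; have := ltn_ord p; clear -n3.
  by rewrite /shift; split_ifs; lia.
have [f03 f12] : f i = addo i 3 /\ f (addo i 1) = addo i 2.
  move: bi; rewrite /is_block subUset !sub1set => /andP [].
  by move=> /(edge_represents _ _ R pf) ? /(edge_represents _ _ R pf).
have [f30 f21] : f (addo i 3) = i /\ f (addo i 2) = addo i 1.
  by rewrite -f03 -f12; have [_ [-> _]] := pf i (ltn_ord i);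
    have [_ [-> _]] := pf (addo i 1) (ltn_ord _).
move=> e; split.
  move=> /imsetP [e0]; rewrite inE => /andP [e0K /R [p [q [fp E]]]] ->; subst e0.
  have lt : relab i p < n - 4.
    (* An edge with an end among the four block points is one of the two block edges, since [f]
       permutes these points. *)
    rewrite ltnNge; apply: contra e0K => /notK [j j4 pE]; subst p.
    rewrite /blockK !inE.
    case: j j4 fp => [|[|[|[|j]]]] // _ fp.
    - by have -> : q = addo i 3; [exact/val_inj/(etrans (esym fp) f03)|rewrite eqxx].
    - by have -> : q = addo i 2; [exact/val_inj/(etrans (esym fp) f12)|rewrite eqxx orbT].
    - by have -> : q = addo i 1; [exact/val_inj/(etrans (esym fp) f21)|rewrite setUC eqxx orbT].
    - by have -> : q = i; [exact/val_inj/(etrans (esym fp) f30)|rewrite setUC eqxx].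
  have [lt' _] := pf' _ lt; rewrite -(relf p q fp) in lt'.
  exists (Ordinal lt), (Ordinal (lt' : relab i q < n - 4)); split; first exact/esym/relf.
  exact: relab_image.
move=> [x [y [fx ->]]]; have xn : x < n by have := ltn_ord x; lia.
have pn := shift_lt sn xn; have [fpn _] := pf _ pn.
pose p := Ordinal pn; pose q := Ordinal (fpn : f p < n).
have px : relab i p = x by rewrite relab_shift // shiftK.
have qy : relab i q = y by rewrite (relf p q) // px.
apply/imsetP; exists [set p; q]; last by rewrite (relab_image px qy).
rewrite inE; apply/andP; split; last by apply/(edge_represents _ _ R pf).
by apply/negP => /inK; rewrite px; have := ltn_ord x; lia.
Qed.

Lemma remove_block_degree n (M : {set {set 'I_n}}) (i : 'I_n) : 3 < n ->
  is_matching M -> is_block M i ->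
  is_matching (remove_block M i) /\
  (dcm_degree M = 1 <-> dcm_degree (remove_block M i) = 1).
Proof.
move=> n3 /matching_represented [f [mf R]] bi.
have hb : has_block n f i by apply/(is_block_has_block _ n3 R mf.1).
have [mf' uf'] := remove_block_rotf n3 (ltn_ord i) mf hb.
have R' := remove_block_represents n3 R mf bi.
split; first exact: represents_matching R' mf'.
by rewrite (degree1_unique R mf) (degree1_unique R' mf').
Qed.

(** * Rings as involutions *)

Lemma ringA_represents n : ~~ odd n -> represents (ringA n) ringA_fun.
Proof.
move=> en e; have S (x : 'I_n) : ~~ odd x -> ordS x = x.+1 :> nat.
  by move=> ex; rewrite /= modn_small //; have := ltn_ord x; lia.
split=> [/imsetP [x]|[x [y [fx ->]]]].
  rewrite inE => ex ->; exists x, (ordS x); split=> //.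
  by rewrite S // /ringA_fun (negbTE ex).
move: fx; rewrite /ringA_fun; case ox: (odd x) => fx; apply/imsetP.
  have ey : ~~ odd y by lia.
  exists y; rewrite ?inE // setUC; congr [set _; _]; apply: val_inj.
  by rewrite [RHS]S //; change (x = y.+1 :> nat); lia.
exists x; rewrite ?inE ?ox //; congr [set _; _]; apply: val_inj.
by rewrite [RHS]S ?ox.
Qed.

Lemma ringB_represents n : ~~ odd n -> represents (ringB n) (ringB_fun n).
Proof.
move=> en e; have S (x : 'I_n) : ordS x = (if x.+1 == n then 0 else x.+1) :> nat.
  rewrite /=; case: eqP => [->|]; first by rewrite modnn.
  by move=> ?; rewrite modn_small //; have := ltn_ord x; lia.
split=> [/imsetP [x]|[x [y [fx ->]]]].
  by rewrite inE => ox ->; exists x, (ordS x); split=> //; rewrite S /ringB_fun ox.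
move: fx; rewrite /ringB_fun; case ox: (odd x) => fx; apply/imsetP.
  by exists x; rewrite ?inE //; congr [set _; _]; apply: val_inj; rewrite [RHS]S.
have xn := ltn_ord x.
have oy : odd y by move: fx; split_ifs; lia.
exists y; rewrite ?inE // setUC; congr [set _; _]; apply: val_inj.
by rewrite [RHS]S; change (x = (if y.+1 == n then 0 else y.+1) :> nat); move: fx; split_ifs; lia.
Qed.

Lemma pairing_ringB n : ~~ odd n -> pairing 0 n (ringB_fun n).
Proof. by move=> en x xn; rewrite /ringB_fun; split_ifs; lia. Qed.

Lemma is_ring_represents n (M : {set {set 'I_n}}) f : ~~ odd n ->
  represents M f -> pairing 0 n f ->
  is_ring M <-> (forall x, x < n -> f x = ringA_fun x) \/
                (forall x, x < n -> f x = ringB_fun n x).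
Proof.
move=> en R pf; have RA := ringA_represents en; have RB := ringB_represents en.
have pA := pairing_ringA en; have pB := pairing_ringB en.
rewrite /is_ring; split=> [/orP [] /eqP E|[] E]; first subst M.
- by left; apply: (represents_fun_inj R RA).
- by subst M; right; apply: (represents_fun_inj R RB).
- by apply/orP; left; apply/eqP/(represents_inj _ RA); apply: (represents_ext _ R).
- by apply/orP; right; apply/eqP/(represents_inj _ RB); apply: (represents_ext _ R).
Qed.

(** * The two implications *)

Lemma Lmatching_degree1 n (M : {set {set 'I_n}}) :
  Lmatching M -> is_matching M /\ dcm_degree M = 1.
Proof.
elim=> {n M} [M mM _|M mM rM|n N i n8 mN bi _ [_ dM]]; split=> //.
- have [f [mf R]] := matching_represented mM.
  by apply/(degree1_unique R mf)/matches4_unique.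
- have [f [mf R]] := matching_represented mM.
  apply/(degree1_unique R mf)/unique_solution_ring6.
  by apply/(is_ring_represents _ R mf.1).
- by have [|_ ->] := remove_block_degree _ mN bi; first by lia.
Qed.

Lemma matching4_is_ring (M : {set {set 'I_4}}) : is_matching M -> is_ring M.
Proof.
move=> mM; have [f [mf R]] := matching_represented mM; have [pf _] := mf.
apply/(is_ring_represents _ R pf) => //.
have p0 := pf 0 isT; have p1 := pf 1 isT; have p2 := pf 2 isT.
case: (matches4_cases mf) => [[e0 e2]|[e0 e1]]; [left|right].
  rewrite e0 in p0; rewrite e2 in p2.
  by case=> [|[|[|[|x]]]] //= _; rewrite /ringA_fun /=; lia.
rewrite e0 in p0; rewrite e1 in p1.
by case=> [|[|[|[|x]]]] //= _; rewrite /ringB_fun /=; lia.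
Qed.

Lemma degree1_Lmatching n (M : {set {set 'I_n}}) : 0 < n -> ~~ odd n ->
  is_matching M -> dcm_degree M = 1 -> Lmatching M.
Proof.
have [k] := ubnP n; elim: k n M => // k IH n M nk n0 en mM dM.
have [f [mf R]] := matching_represented mM.
have uf : unique_solution n f by apply/(degree1_unique R mf).
have [n2|[n4|[n6|n8]]] : n = 2 \/ n = 4 \/ n = 6 \/ 8 <= n by lia.
- by subst n; case: (not_unique_solution2 mf).
- by subst n; apply: L_ring2 => //; apply: matching4_is_ring.
(* A block would leave a matching of size 1, which has no solution; hence there is no block and the
   matching is a ring. *)
- subst n; apply: L_ring3 => //; apply/(is_ring_represents _ R mf.1) => //.
  apply: no_block6_ring => // x x6 hb.
  have [mf' uf'] := @remove_block_rotf 6 f x isT x6 mf hb.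
  by apply: (not_unique_solution2 mf'); apply/uf'.
have n3 : 3 < n by lia.
case: (boolP [exists i, is_block M i]) => [/existsP [i bi]|/existsPn nb].
  have [mM' dM'] := remove_block_degree n3 mM bi.
  by apply: (L_step n8 mM bi); apply: IH => //; [lia|lia|lia|apply/dM'].
case: (no_block_not_unique n8 mf _ uf) => x xn hb.
by have /negP := nb (Ordinal xn); apply; apply/(is_block_has_block _ n3 R mf.1).
Qed.

Theorem mainTheorem13 (k : nat) (hk : (1 <= k)%N) (M : {set {set 'I_(2 * k)}}) :
  is_matching M -> (dcm_degree M = 1%N <-> Lmatching M).
Proof.
move=> mM; split; last by case/Lmatching_degree1.
by apply: degree1_Lmatching => //; lia.
Qed.
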